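(* Let $A$ be a finite alphabet with $|A|=r\ge2$. (1) Let $f$ be an unbounded non-decreasing integer-valued function on $\mathbb{N}$ and let $k>1$ be a fixed integer. Then a $k$-tuple $\vec h$ of reduced words of length at most $n$ chosen uniformly at random generically (as $n\to\infty$) has the central tree property, with $\mathsf{lcp}(\vec h)\le f(n)$. (2) Let $c,c'>0$ be such that $c'\log(2r-1)>2c$. Then an $n^c$-tuple $\vec h$ of reduced words of length at most $n$ chosen uniformly at random generically has the central tree property, with $\mathsf{lcp}(\vec h)\le c'\log n$.
   Context: $\tilde A=A\sqcup A^{-1}$; a word over $\tilde A$ is reduced if it has no factor $aa^{-1}$ with $a\in\tilde A$. A uniformly random tuple of reduced words of length at most $n$ has independent entries, each uniform among all reduced words of length at most $n$. When $n^c$ is not an integer, its integer part is meant; $\log$ is the natural logarithm. For a tuple $\vec h=(h_1,\dots,h_k)$ of reduced words, $\vec h^\pm=(h_1,h_1^{-1},\dots,h_k,h_k^{-1})$, $\mathsf{min}(\vec h)=\min_i|h_i|$, and $\mathsf{lcp}(\vec h)$ is the length of the longest common prefix between two entries (at distinct indices) of $\vec h^\pm$. The tuple has the central tree property if $2\,\mathsf{lcp}(\vec h)<\mathsf{min}(\vec h)$. A property holds generically if its probability tends to $1$ as $n\to\infty$. *)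

(* Defs.v *)
From mathcomp Require Import all_boot all_order all_algebra.
From mathcomp Require Import all_classical all_reals all_analysis.

Set Implicit Arguments.
Unset Strict Implicit.
Unset Printing Implicit Defensive.

Import Order.TTheory GRing.Theory Num.Theory.
Import numFieldNormedType.Exports.

Local Open Scope ring_scope.

(* (a, false) stands for a and (a, true) for its formal inverse a^-1. *)
Definition letter (A : finType) : finType := (A * bool)%type.

Definition linv (A : finType) (x : letter A) : letter A := (x.1, ~~ x.2).

Definition winv (A : finType) (w : seq (letter A)) : seq (letter A) :=
  rev (map (@linv A) w).

Definition reduced (A : finType) (w : seq (letter A)) : bool :=
  [forall x : letter A, ~~ infix [:: x; linv x] w].

(* The finite type of the reduced words of length at most n. *)
Definition rword (A : finType) (n : nat) : finType :=
  {w : n.-bseq (letter A) | reduced w}.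

Definition word_of (A : finType) (n : nat) (w : rword A n) : seq (letter A) :=
  val (val w).

Definition tuple_words (A : finType) (n k : nat) (h : {ffun 'I_k -> rword A n})
    (i : 'I_k) : seq (letter A) := word_of (h i).

Definition lcp_words (T : eqType) (u v : seq T) : nat :=
  \max_(m < (size u).+1 | prefix (take m u) v) m.

(* The 2k entries of (h_1, h_1^-1, ..., h_k, h_k^-1), indexed by 'I_k * bool:
   (i, false) is the index of h_i and (i, true) that of h_i^-1. *)
Definition pm (A : finType) (k : nat) (h : 'I_k -> seq (letter A))
    (p : 'I_k * bool) : seq (letter A) :=
  if p.2 then winv (h p.1) else h p.1.

Definition lcp (A : finType) (k : nat) (h : 'I_k -> seq (letter A)) : nat :=
  \max_(p : 'I_k * bool) \max_(q : 'I_k * bool | p != q)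
    lcp_words (pm h p) (pm h q).

(* Starting from the maximal length makes this the true minimum as soon as
   k > 0, with no dependence on an arbitrary default value. *)
Definition minlen (A : finType) (k : nat) (h : 'I_k -> seq (letter A)) : nat :=
  \big[minn/(\max_(i < k) size (h i))%N]_(i < k) size (h i).

Definition central_tree (A : finType) (k : nat) (h : 'I_k -> seq (letter A)) :
  bool := (2 * lcp h < minlen h)%N.

(* Probability of P for a k-tuple with independent entries, each of them uniform
   among the reduced words of length at most n. *)
Definition prob_words (R : realType) (A : finType) (n k : nat)
    (P : ('I_k -> seq (letter A)) -> bool) : R :=
  \sum_(h : {ffun 'I_k -> rword A n} | P (tuple_words h))
    \prod_(i < k) #|rword A n|%:R^-1.

(* The size k n of the random tuple may depend on n. *)
Definition generically (R : realType) (A : finType) (k : nat -> nat)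
    (P : forall n, ('I_(k n) -> seq (letter A)) -> bool) : Prop :=
  ((fun n : nat => prob_words R n (P n)) @ \oo --> (1 : R))%classic.

(* Main.v *)
(* Let q = 2r - 1.  There are at least q^n reduced words of length at most n, at
   most 4 q^m of them have length at most m, and at most 2 q^(n-s) begin with a
   given word of length s.  Hence, when 3s <= n, each of the following events has
   probability at most 4 q^(-s): some h_i is shorter than 2s; two given entries
   of the tuple of the h_i and their inverses have length at least 2s and agree
   on their first s letters.  If none of them occurs then lcp < s and min >= 2s.
   There are (2k)^2 such events, so the tuple fails with probability at most
   16 k^2 q^(-s), and it remains to let s grow slowly enough below f(n), or to
   take s the integer part of c' log n. *)

Require Import Defs.
From mathcomp Require Import all_boot all_order all_algebra.
From mathcomp Require Import all_classical all_reals all_analysis.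
From mathcomp Require Import zify lra.

Set Implicit Arguments.
Unset Strict Implicit.
Unset Printing Implicit Defensive.

Import Order.TTheory GRing.Theory Num.Theory.
Import numFieldNormedType.Exports.

Local Open Scope nat_scope.

(** * Reduced words as paths, and their enumeration after a given letter *)

Section ReducedWords.
Variable A : finType.
Implicit Types (x y : letter A) (u v w : seq (letter A)).

Definition noncancel x y := y != linv x.

Lemma linvK : involutive (@linv A).
Proof. by case=> a b; rewrite /linv /= negbK. Qed.

(** Having no factor $xx^{-1}$ is a condition on consecutive letters only, which gives access to the
    theory of [path] and [sorted]. *)
Lemma reducedE w : reduced w = sorted noncancel w.
Proof.
rewrite /reduced; elim: w => [|x [|y w] IH].
- by apply/forallP => x.
- by apply/forallP => y; rewrite infixs1 /= eqseq_cons andbF.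
rewrite [RHS]/= -[path _ _ _]/(sorted noncancel (y :: w)) -IH.
apply/forallP/andP => [H | [xy /forallP H] z].
  split; first by apply: contraNN (H x) => /eqP->; rewrite infix_consl /= !eqxx prefix0s.
  apply/forallP => z; apply: contraNN (H z) => zw.
  by rewrite infix_consl zw orbT.
rewrite infix_consl negb_or H andbT /=.
by apply: contraNN xy => /and3P[/eqP<- /eqP<-].
Qed.

Lemma size_winv w : size (winv w) = size w.
Proof. by rewrite size_rev size_map. Qed.

Lemma winvK : involutive (@winv A).
Proof. by move=> w; rewrite /winv map_rev revK mapK //; apply: linvK. Qed.

Lemma winv_cat u v : winv (u ++ v) = winv v ++ winv u.
Proof. by rewrite /winv map_cat rev_cat. Qed.

Lemma reduced_winv w : reduced (winv w) = reduced w.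
Proof.
rewrite !reducedE /winv rev_sorted sorted_map; apply: eq_sorted => x y.
by rewrite /= /noncancel linvK eq_sym.
Qed.

(** The letter [x] precedes the words without belonging to them, so that every letter, including the
    first, has exactly $2|A|-1$ choices and the count is an exact power. *)
Fixpoint reduced_paths x n : seq (seq (letter A)) :=
  if n is m.+1
  then [seq y :: w | y <- enum [pred y | noncancel x y], w <- reduced_paths y m]
  else [:: [::]].

Lemma mem_reduced_paths x n w :
  (w \in reduced_paths x n) = (size w == n) && path noncancel x w.
Proof.
elim: n x w => [|n IH] x w /=; first by case: w.
apply/allpairsPdep/andP => [[y [u [xy uy ->]]]|].
  by move: xy uy; rewrite mem_enum inE IH /= eqSS => -> /andP[-> ->].
case: w => [[]//|y w [/= sw /andP[xy yw]]].
by exists y, w; rewrite mem_enum inE IH -(eqSS (size w)) sw xy yw.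
Qed.

Lemma uniq_reduced_paths x n : uniq (reduced_paths x n).
Proof.
elim: n x => [|n IH] x //=.
apply: allpairs_uniq_dep => [|y _|]; rewrite ?enum_uniq //.
by move=> [y u] [z v] /= _ _ [-> ->].
Qed.

Lemma size_reduced_paths x n : size (reduced_paths x n) = (2 * #|A| - 1) ^ n.
Proof.
elim: n x => [|n IH] x //=; rewrite size_allpairs_dep.
rewrite (eq_map (g := fun=> (2 * #|A| - 1) ^ n)) // sumnE big_map big_const_seq.
rewrite count_predT -cardE (eq_card (B := predC1 (linv x))) // cardC1.
rewrite card_prod card_bool iter_addn addn0 expnS mulnC mulnC [#|A| * 2]mulnC.
by rewrite subn1 mulnC.
Qed.

Definition reduced_paths_le x n : seq (seq (letter A)) :=
  flatten [seq reduced_paths x m | m <- iota 0 n.+1].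

Lemma mem_reduced_paths_le x n w :
  (w \in reduced_paths_le x n) = (size w <= n) && path noncancel x w.
Proof.
apply/flatten_mapP/andP => [[m]|[sw pw]].
  by rewrite mem_iota mem_reduced_paths => mn /andP[/eqP-> ->].
by exists (size w); rewrite ?mem_reduced_paths ?eqxx // mem_iota.
Qed.

End ReducedWords.

Lemma sum_expn_le q n : 1 < q -> \sum_(0 <= m < n.+1) q ^ m <= 2 * q ^ n.
Proof.
move=> q1; elim: n => [|n IH]; first by rewrite big_nat1 expn0.
rewrite big_nat_recr //= mul2n -addnn leq_add2r (leq_trans IH) //.
by rewrite expnS leq_mul2r q1 orbT.
Qed.

(** * Counting reduced words that are short, have a given prefix, or overlap their inverse *)

Section CountingWords.
Variables (A : finType) (card_A : 1 < #|A|).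
Implicit Types (x y : letter A) (u v w : seq (letter A)).

Local Notation q := (2 * #|A| - 1).

Let q_gt1 : 1 < q. Proof. by move: card_A; lia. Qed.

Lemma size_reduced_paths_le x n : size (reduced_paths_le x n) <= 2 * q ^ n.
Proof.
apply: leq_trans (sum_expn_le n q_gt1).
rewrite size_flatten /shape -map_comp sumnE big_map.
by rewrite /index_iota subn0 leq_sum // => m _; rewrite /= size_reduced_paths.
Qed.

Lemma word_of_inj n : injective (@word_of A n).
Proof. by move=> v w /val_inj/val_inj. Qed.

Lemma word_ofP n (w : rword A n) : size (word_of w) <= n /\ reduced (word_of w).
Proof. by split; [exact: size_bseq | exact: (valP w)]. Qed.

Lemma exists_rword n w : size w <= n -> reduced w ->
  exists v : rword A n, word_of v = w.
Proof. by move=> sw rw; exists (exist _ (Bseq sw) rw). Qed.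

Lemma card_rword_le n (P : pred (rword A n)) (s : seq (seq (letter A))) :
  (forall w : rword A n, P w -> word_of w \in s) -> #|P| <= size s.
Proof.
move=> sP; rewrite cardE -(size_map (@word_of A n)).
apply: uniq_leq_size; first by rewrite map_inj_uniq ?enum_uniq //; apply: word_of_inj.
by move=> _ /mapP[w Pw ->]; apply: sP; rewrite mem_enum in Pw.
Qed.

(** The words of length exactly [n] that may follow one fixed letter already suffice. *)
Lemma card_rword_ge n : q ^ n <= #|rword A n|.
Proof.
have [x _] : exists x : letter A, x \in letter A.
  by apply/card_gt0P; rewrite card_prod card_bool; move: card_A; lia.
rewrite -(size_reduced_paths x) cardE -(size_map (@word_of A n)).
apply: uniq_leq_size (uniq_reduced_paths x n) _ => w.
rewrite mem_reduced_paths => /andP[/eqP sw pw].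
have [||v <-] := @exists_rword n w; rewrite ?sw ?reducedE ?(path_sorted pw) //.
by rewrite map_f // mem_enum.
Qed.

(* A nonempty reduced word can be extended to the left by one of any two
   distinct letters. *)
Lemma reduced_words_le n :
  exists2 s : seq (seq (letter A)), size s <= 4 * q ^ n
  & forall w, size w <= n -> reduced w -> w \in s.
Proof.
have [a _] : exists a : A, a \in A by apply/card_gt0P; apply: ltnW.
pose x := (a, false) : letter A; pose y := (a, true) : letter A.
exists (reduced_paths_le x n ++ reduced_paths_le y n).
  rewrite size_cat (@leq_trans (2 * q ^ n + 2 * q ^ n)) //; last by rewrite -mulnDl.
  by rewrite leq_add ?size_reduced_paths_le.
case=> [|z w] sw; first by rewrite mem_cat !mem_reduced_paths_le.
rewrite reducedE mem_cat !mem_reduced_paths_le sw /= => ->; rewrite !andbT.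
rewrite /noncancel -negb_and; apply/negP => /andP[/eqP->].
by rewrite xpair_eqE andbF.
Qed.

Lemma card_short_words n m :
  #|[pred w : rword A n | size (word_of w) <= m]| <= 4 * q ^ m.
Proof.
have [s ss sP] := reduced_words_le m.
apply: leq_trans ss; apply: card_rword_le => w /= sw.
by apply: sP => //; have [] := word_ofP w.
Qed.

(** What follows [u] is a path of length at most [n - size u] issued from the last letter of [u].
    The factor [q ^ size u] stands on the left to avoid a truncated subtraction in the exponent; if
    [u] is longer than [n], there is no such word. *)
Lemma card_words_with_prefix n u : 0 < size u ->
  #|[pred w : rword A n | prefix u (word_of w)]| * q ^ size u <= 2 * q ^ n.
Proof.
case: u => // x u _; set s := size _.
have [sn|sn] := leqP s n; last first.
  rewrite eq_card0 // => w; rewrite !inE; apply/negP => /size_prefix us.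
  by have [/(leq_trans us)] := word_ofP w; rewrite leqNgt sn.
rewrite -[in X in _ <= X](subnK sn) expnD mulnA leq_mul2r; apply/orP; right.
apply: leq_trans (size_reduced_paths_le (last x u) (n - s)).
rewrite -(size_map (cat (x :: u))); apply: card_rword_le => w /prefixP[v wE].
have [] := word_ofP w; rewrite wE reducedE [X in sorted _ X -> _]cat_cons.
rewrite [sorted _ _]cat_path size_cat => sw /andP[_ pv].
apply: (map_f (cat (x :: u))); rewrite mem_reduced_paths_le pv andbT.
by rewrite -(leq_add2l s) subnKC.
Qed.

(* If u begins both w and its inverse and 2|u| <= |w|, then w ends with the
   inverse of u, so w is determined by its prefix of length |w| - |u|. *)
Lemma card_self_overlap n s :
  #|[pred w : rword A n | (2 * s <= size (word_of w)) &&
      (take s (word_of w) == take s (winv (word_of w)))]| * q ^ s <= 4 * q ^ n.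
Proof.
have [sn|sn] := leqP s n; last first.
  rewrite eq_card0 // => w; rewrite !inE; apply/negP => /andP[sw _].
  by have [wn _] := word_ofP w; lia.
have [t st tP] := reduced_words_le (n - s).
rewrite -[in X in _ <= X](subnK sn) expnD mulnA leq_mul2r; apply/orP; right.
apply: leq_trans st; rewrite -(size_map (fun u => u ++ winv (take s u))).
apply: card_rword_le => w /= /andP[sw /eqP tw].
have [wn rw] := word_ofP w; move: (word_of w) => v in sw tw wn rw *.
have sub m : 2 * s <= m -> (s <= m - s) /\ s <= m by lia.
have [sv vs] := sub _ sw.
pose u := take (size v - s) v.
have su : size u = size v - s by rewrite size_takel // leq_subr.
have -> : v = u ++ winv (take s u).
  rewrite -[LHS](cat_take_drop (size v - s)) -/u; congr (_ ++ _).
  (* As [s <= size v - s], the first [s] letters of [u] are those of [v]; by [tw] they also open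
     [winv v], so their inverse ends [v]. *)
  rewrite take_takel //.
  rewrite tw -[in RHS](cat_take_drop (size v - s) v) winv_cat take_size_cat.
    by rewrite winvK.
  by rewrite size_winv size_drop subKn.
apply/mapP; exists u => //; apply: tP; first by rewrite su leq_sub2r.
by move: rw; rewrite !reducedE; apply: take_sorted.
Qed.

End CountingWords.

(** * Averaging over one coordinate of a tuple *)

Section Slices.
Variables (I T : finType).
Implicit Types (h : {ffun I -> T}) (Q : pred {ffun I -> T}).

Definition update h j w : {ffun I -> T} := [ffun i => if i == j then w else h i].

Lemma updateE h j w i : update h j w i = if i == j then w else h i.
Proof. by rewrite ffunE. Qed.

(* The pairs (h, w) are permuted by exchanging w with the j-th value of h. *)
Lemma sum_card_slices Q j :
  \sum_h #|[pred w | Q (update h j w)]| = #|Q| * #|T|.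
Proof.
pose swap (x : {ffun I -> T} * T) := (update x.1 j x.2, x.1 j).
have swapK : involutive swap.
  case=> h w; rewrite /swap /= updateE eqxx; congr (_, _).
  by apply/ffunP => i; rewrite !updateE; case: eqP => [->|].
under eq_bigr do rewrite -sum1_card big_mkcond /=.
rewrite pair_big /= (reindex_inj (inv_inj swapK)) /=.
under eq_bigr => x _ do
  rewrite inE -[update _ _ _]/((swap (swap x)).1) swapK.
rewrite -(pair_big xpredT xpredT (fun h (_ : T) => if Q h then 1 else 0)) /=.
under eq_bigr do rewrite sum_nat_const.
by rewrite -big_distrr /= -big_mkcond sum1_card mulnC.
Qed.

(** This is where independence enters: if, with the other coordinates fixed, the [j]-th one
    satisfies [Q] with probability at most $b/a$, then so does the whole tuple. Fractions are
    cross-multiplied to stay in the naturals. *)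
Lemma card_slice_le Q j a b : 0 < #|T| ->
  (forall h, #|[pred w | Q (update h j w)]| * a <= b * #|T|) ->
  #|Q| * a <= b * #|{ffun I -> T}|.
Proof.
move=> T0 slice_le; rewrite -(leq_pmul2r T0) mulnAC -(sum_card_slices Q j).
rewrite big_distrl /=; apply: (@leq_trans (\sum_(h : {ffun I -> T}) b * #|T|)).
  by apply: leq_sum => h _; apply: slice_le.
by rewrite sum_nat_const mulnCA mulnA.
Qed.

End Slices.

(** * Bad events and the union bound *)

Section BadEvents.
Variables (A : finType) (card_A : 1 < #|A|).

Local Notation q := (2 * #|A| - 1).

(** Inversion is injective on the reduced words of length at most [n], which reduces this to the
    count by prefix. *)
Lemma card_words_with_suffix n u : 0 < size u ->
  #|[pred w : rword A n | prefix u (winv (word_of w))]| * q ^ size u <= 2 * q ^ n.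
Proof.
move=> u0; apply: leq_trans (card_words_with_prefix card_A n u0).
have winvP (w : rword A n) : exists v : rword A n, word_of v = winv (word_of w).
  by have [wn rw] := word_ofP w; apply: exists_rword; rewrite ?size_winv ?reduced_winv.
have [f fE] := choice winvP.
have f_inj : injective f.
  move=> v w vw; apply: word_of_inj; apply: (inv_inj (@winvK A)).
  by rewrite -!fE vw.
rewrite leq_mul2r -(fintype.card_image f_inj); apply/orP; right.
apply: subset_leq_card; apply/fintype.subsetP => v /fintype.imageP[w ww ->]; move: ww.
by rewrite !inE fE.
Qed.

(* The diagonal indices p = p' carry the event that h_p is short, so that all
   the bad events are indexed by pairs. *)
Definition bad_event k s (p p' : 'I_k * bool) (h : 'I_k -> seq (letter A)) :=
  if p == p' then size (h p.1) < 2 * s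
  else [&& 2 * s <= size (h p.1), 2 * s <= size (h p'.1)
         & take s (pm h p) == take s (pm h p')].

Lemma size_pm k (h : 'I_k -> seq (letter A)) p : size (pm h p) = size (h p.1).
Proof. by rewrite /pm; case: p.2; rewrite ?size_winv. Qed.

(** Only the word behind [p'] varies. On the diagonal it is short, and $4q^{2s}q^s\le 4q^n$ since
    $3s\le n$. If [p] and [p'] are a word and its own inverse, it overlaps its inverse. Otherwise
    the entry at [p] is fixed and prescribes the first [s] letters of the entry at [p']. *)
Lemma card_bad_event_slice n k s p p' (h : {ffun 'I_k -> rword A n}) :
  0 < s -> 3 * s <= n ->
  #|[pred w | bad_event s p p' (tuple_words (update h p'.1 w))]| * q ^ s
    <= 4 * q ^ n.
Proof.
move=> s0 sn; rewrite /bad_event; have [<-|pp'] := eqVneq p p'.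
  apply: (@leq_trans (4 * q ^ (2 * s) * q ^ s)).
    rewrite leq_mul2r; apply/orP; right.
    apply: leq_trans (card_short_words card_A n (2 * s)).
    apply: subset_leq_card; apply/fintype.subsetP => w.
    by rewrite !inE /tuple_words updateE eqxx; apply: ltnW.
  have q0 : 0 < q by move: card_A; lia.
  by rewrite -mulnA -expnD leq_mul2l /= leq_pexp2l // -mulSnr.
have [p1|p1] := eqVneq p.1 p'.1.
  apply: leq_trans (card_self_overlap card_A n s).
  rewrite leq_mul2r; apply/orP; right.
  apply: subset_leq_card; apply/fintype.subsetP => w.
  rewrite !inE /pm /tuple_words !updateE p1 eqxx => /and3P[-> _].
  move: pp' p1; case: p => i b; case: p' => j b' /= + ij; rewrite ij.
  by case: b b' => [] [] /=; rewrite ?eqxx => // _ /eqP->.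
(* A short fixed entry makes the event empty; a long one ensures that the prescribed prefix [u] has
   exactly [s] letters. *)
have [short|long] := ltnP (size (word_of (h p.1))) (2 * s).
  rewrite eq_card0 // => w.
  by rewrite !inE /tuple_words updateE (negPf p1) leqNgt short.
pose u := take s (pm (tuple_words h) p).
have su : size u = s by rewrite size_takel // size_pm (leq_trans _ long) // leq_pmull.
apply: (@leq_trans (2 * q ^ n)); last by rewrite leq_mul2r orbT.
rewrite -su; have u0 : 0 < size u by rewrite su.
have uE w : take s (pm (tuple_words (update h p'.1 w)) p) = u.
  by rewrite /u /pm /tuple_words updateE (negPf p1).
case p2 : p'.2.
  apply: leq_trans (card_words_with_suffix n u0).
  rewrite leq_mul2r; apply/orP; right.
  apply: subset_leq_card; apply/fintype.subsetP => w.
  rewrite !inE su prefixE su uE => /and3P[_ _].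
  by rewrite /pm p2 /tuple_words updateE eqxx eq_sym.
apply: leq_trans (card_words_with_prefix card_A n u0).
rewrite leq_mul2r; apply/orP; right.
apply: subset_leq_card; apply/fintype.subsetP => w.
rewrite !inE su prefixE su uE => /and3P[_ _].
by rewrite /pm p2 /tuple_words updateE eqxx eq_sym.
Qed.

(** Average the slice bound over the entry [p'.1], using that there are at least [q ^ n] words to
    choose from. *)
Lemma card_bad_event n k s (p p' : 'I_k * bool) : 0 < s -> 3 * s <= n ->
  #|[pred h : {ffun 'I_k -> rword A n} | bad_event s p p' (tuple_words h)]| * q ^ s
    <= 4 * #|{ffun 'I_k -> rword A n}|.
Proof.
move=> s0 sn; have Bn := card_rword_ge card_A n.
apply: (@card_slice_le _ _ _ p'.1) => [|h].
  by apply: leq_trans Bn; rewrite expn_gt0; apply/orP; left; move: card_A; lia.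
apply: leq_trans (card_bad_event_slice _ _ _ s0 sn) _.
by rewrite leq_mul2l Bn orbT.
Qed.

Lemma lcp_words_lt s (v w : seq (letter A)) : s <= size v ->
  take s v != take s w -> lcp_words v w < s.
Proof.
case: s => [|s]; first by rewrite !take0 eqxx.
move=> sv vw; rewrite ltnS; apply/bigmax_leqP => m vmw.
rewrite leqNgt; apply: contraNN vw => sm.
move: vmw; rewrite prefixE => /eqP tw.
rewrite -(take_takel v sm) -tw take_takel // size_takel //.
by rewrite -ltnS ltn_ord.
Qed.

Lemma central_tree_of_not_bad k s (h : 'I_k -> seq (letter A)) :
  0 < k -> 0 < s -> (forall p p', ~~ bad_event s p p' h) ->
  central_tree h /\ lcp h < s.
Proof.
move=> k0 s0 good.
have long i : 2 * s <= size (h i).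
  by have := good (i, false) (i, false); rewrite /bad_event eqxx -leqNgt.
have lcp_lt : lcp h < s.
  rewrite -(prednK s0) ltnS; apply/bigmax_leqP => p _; apply/bigmax_leqP => p' pp'.
  rewrite -ltnS prednK //; apply: lcp_words_lt.
    by rewrite size_pm (leq_trans _ (long _)) // leq_pmull.
  by have := good p p'; rewrite /bad_event (negPf pp') !long.
split=> //; apply: (@leq_trans (2 * s)); first by rewrite ltn_pmul2l.
rewrite /minlen; elim/big_ind: _ => [|m m' sm sm'|i _]; last exact: long.
  (* The starting value of the minimum is the maximal length, which is at least [2 * s] because
     [0 < k] provides an entry. *)
  exact: leq_trans (long (Ordinal k0)) (leq_bigmax _).
by rewrite leq_min sm.
Qed.

(** Union bound: a tuple violating [P] lies in one of the $(2k)^2$ bad events, each of proportion at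
    most $4q^{-s}$. *)
Lemma card_not_central n k s (P : ('I_k -> seq (letter A)) -> bool) :
  0 < k -> 0 < s -> 3 * s <= n ->
  (forall h, central_tree h -> lcp h < s -> P h) ->
  #|[pred h : {ffun 'I_k -> rword A n} | ~~ P (tuple_words h)]| * q ^ s
    <= 16 * k ^ 2 * #|{ffun 'I_k -> rword A n}|.
Proof.
move=> k0 s0 sn PP.
pose E (x : ('I_k * bool) * ('I_k * bool)) (h : {ffun 'I_k -> rword A n}) :=
  bad_event s x.1 x.2 (tuple_words h).
apply: (@leq_trans ((\sum_x #|E x|) * q ^ s)).
  rewrite leq_mul2r; apply/orP; right.
  rewrite -sum1_card -[X in _ <= X](eq_bigr _ (fun x _ => sum1_card (E x))).
  rewrite (exchange_big_dep predT) //= big_mkcond leq_sum // => h _.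
  case: ifPn => // nP; rewrite sum1_card lt0n; apply: contraNN nP.
  move=> /eqP E0; have [|c l] := central_tree_of_not_bad (h := tuple_words h) k0 s0.
    by move=> p p'; apply/negP => b; have := card0_eq E0 (p, p'); rewrite inE [_ \in _]b.
  exact: PP.
rewrite big_distrl /=.
apply: (@leq_trans (\sum_(x : ('I_k * bool) * ('I_k * bool))
  4 * #|{ffun 'I_k -> rword A n}|)).
  by apply: leq_sum => x _; apply: card_bad_event.
rewrite sum_nat_const !card_prod card_ord card_bool.
by rewrite mulnA leq_mul2r; apply/orP; right; lia.
Qed.

End BadEvents.

Local Open Scope ring_scope.

(** * From counts to probabilities, and the choice of [s] as a function of [n] *)

Section Limits.
Variables (R : realType) (A : finType) (card_A : (1 < #|A|)%N).

Local Notation q := (2 * #|A| - 1)%N.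

Lemma prob_wordsE n k (P : ('I_k -> seq (letter A)) -> bool) :
  prob_words R n P = #|[pred h : {ffun 'I_k -> rword A n} | P (tuple_words h)]|%:R
                     / #|{ffun 'I_k -> rword A n}|%:R.
Proof.
rewrite /prob_words prodr_const card_ord sumr_const card_ffun card_ord.
by rewrite natrX exprVn -[LHS]mulr_natl.
Qed.

Lemma card_tuples_gt0 n k : (0 < #|{ffun 'I_k -> rword A n}|)%N.
Proof.
rewrite card_ffun expn_gt0 (leq_trans _ (card_rword_ge card_A n)) // expn_gt0.
by apply/orP; left; move: card_A; lia.
Qed.

Lemma prob_words_le1 n k (P : ('I_k -> seq (letter A)) -> bool) :
  prob_words R n P <= 1.
Proof.
by rewrite prob_wordsE ler_pdivrMr ?ltr0n ?card_tuples_gt0 // mul1r ler_nat max_card.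
Qed.

Lemma prob_words_ge n k s (P : ('I_k -> seq (letter A)) -> bool) :
  (0 < k)%N -> (0 < s)%N -> (3 * s <= n)%N ->
  (forall h, central_tree h -> (lcp h < s)%N -> P h) ->
  1 - 16 * (k%:R ^+ 2 / q%:R ^+ s) <= prob_words R n P.
Proof.
move=> k0 s0 sn PP; rewrite prob_wordsE.
have := card_not_central card_A k0 s0 sn PP.
have := cardC [pred h : {ffun 'I_k -> rword A n} | P (tuple_words h)].
set a := #|[pred h | _]|; rewrite [X in (a + X)%N](_ : _ =
  #|[pred h : {ffun 'I_k -> rword A n} | ~~ P (tuple_words h)]|); last exact: eq_card.
set b := #|[pred h | ~~ _]|; have := card_tuples_gt0 n k.
set N := #|{ffun _}| => N0 abN bN.
have N0R : 0 < N%:R :> R by rewrite ltr0n.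
have q0 : 0 < q%:R ^+ s :> R by rewrite exprn_gt0 // ltr0n; move: card_A; lia.
rewrite ler_pdivlMr // mulrBl mul1r lerBlDr -[X in X%:R <= _]abN natrD lerD2l.
rewrite mulrA mulrAC ler_pdivlMr // -natrX -[_ ^+ 2]natrX -!natrM ler_nat.
exact: bN.
Qed.

(** The probability is eventually squeezed between [1 - 16 * g n] and [1]. *)
Lemma generically_of_rate (k s : nat -> nat) (g : nat -> R)
    (P : forall n, ('I_(k n) -> seq (letter A)) -> bool) :
  (\forall n \near \oo, [/\ (0 < k n)%N, (0 < s n)%N & (3 * s n <= n)%N])%classic ->
  (\forall n \near \oo, forall h, central_tree h -> (lcp h < s n)%N -> P n h)%classic ->
  (\forall n \near \oo, (k n)%:R ^+ 2 / q%:R ^+ s n <= g n)%classic ->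
  (g n @[n --> \oo] --> (0 : R))%classic ->
  generically R P.
Proof.
move=> ks PP kg g0; apply: (squeeze_cvgr (f := fun n => 1 - 16 * g n) (h := fun=> 1)).
- near=> n; rewrite prob_words_le1 andbT.
  have [|k0 s0 sn] := near ks n; first by [].
  apply: (le_trans _ (prob_words_ge k0 s0 sn _)); last by near: n.
  by rewrite lerB // ler_pM2l //; near: n.
- rewrite -[X in (_ --> X)%classic]subr0 -[X in (_ --> _ - X)%classic](mulr0 16).
  by apply: cvgB; [exact: cvg_cst | apply: cvgM => //; exact: cvg_cst].
- exact: cvg_cst.
Unshelve. all: by end_near. Qed.

Lemma ln_natr_cvg_pinfty : (ln (n%:R : R) @[n --> \oo] --> +oo)%classic.
Proof.
apply/cvgryPge => M; near=> n.
rewrite -[M]expRK ler_ln ?posrE ?expR_gt0 //.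
  by near: n; apply: nbhs_infty_ger.
by rewrite ltr0n; near: n; apply: nbhs_infty_ge.
Unshelve. all: by end_near. Qed.

Lemma generic_bounded_lcp (f : nat -> int) (k : nat) :
  {homo f : m n / (m <= n)%N >-> m <= n} ->
  (forall M : int, exists n : nat, M < `|f n|) -> (1 < k)%N ->
  generically R (k := fun=> k)
    (fun n (h : 'I_k -> seq (letter A)) =>
       central_tree h && ((lcp h)%:Z <= f n)).
Proof.
move=> f_homo f_unb k1.
have f_ge (M : nat) : (\forall n \near \oo, M%:Z <= f n)%classic.
  (* Unboundedness concerns absolute values. Adding [|f 0|] excludes a large negative value, since
     [f] never goes below [f 0]; hence [f n0] exceeds [M]. *)
  have [n0 n0M] := f_unb (M%:Z + `|f 0%N|).
  near=> n; have n0n : (n0 <= n)%N by near: n; apply: nbhs_infty_ge.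
  by have := f_homo _ _ (leq0n n0); have := f_homo _ _ n0n; move: n0M; lia.
(* The first argument controls [lcp], the second ensures [3 * s n <= n]; both tend to infinity. *)
pose s n := minn `|f n|%N (n %/ 3).
have s_ge M : (\forall n \near \oo, (M <= s n)%N)%classic.
  near=> n; rewrite leq_min; apply/andP; split.
    have : M%:Z <= f n by near: n; apply: f_ge.
    by lia.
  by rewrite leq_divRL //; near: n; apply: nbhs_infty_ge.
apply: (@generically_of_rate _ s (fun n => k%:R ^+ 2 * q%:R^-1 ^+ s n)).
- near=> n; split; [exact: ltnW | by near: n; apply: s_ge |].
  by rewrite mulnC -leq_divRL // geq_minr.
- near=> n => h -> /= lh; have : 0%:Z <= f n by near: n; apply: f_ge.
  by move: lh; rewrite /s; lia.
- by near=> n; rewrite exprVn.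
- rewrite -(mulr0 (k%:R ^+ 2)); apply: cvgM; first exact: cvg_cst.
  apply: (cvg_comp s (fun m => q%:R^-1 ^+ m)); first by apply/cvgnyPge.
  apply: cvg_expr; rewrite ger0_norm ?invr_ge0 ?ler0n // invf_lt1 ?ltr1n ?ltr0n //;
    move: card_A; lia.
Unshelve. all: by end_near. Qed.

(** With $s=\lfloor c'\log n\rfloor$ one has $k^2\le n^{2c}$ and $q^s\ge n^{c'\log q}/q$, so
    $k^2q^{-s}\le q\,n^{-d}$, where $d=c'\log q-2c>0$. *)
Lemma generic_log_lcp (c c' : R) :
  0 < c -> 0 < c' -> 2 * c < c' * ln (2 * #|A|%:R - 1) ->
  generically R (k := fun n => Num.truncn (n%:R `^ c))
    (fun n (h : 'I_(Num.truncn (n%:R `^ c)) -> seq (letter A)) =>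
       central_tree h && ((lcp h)%:R <= c' * ln (n%:R : R))).
Proof.
move=> c0 c'0 cc'; pose lq : R := ln (2 * #|A|%:R - 1).
have qE : 2 * #|A|%:R - 1 = q%:R :> R.
  by rewrite natrB ?natrM //; move: card_A; lia.
have q1 : 1 < q%:R :> R by rewrite ltr1n; move: card_A; lia.
have lq0 : 0 < lq by rewrite /lq qE ln_gt0.
have lqE : expR lq = q%:R by rewrite /lq qE lnK // posrE (lt_trans _ q1).
have powRE n : (0 < n)%N -> n%:R `^ c = expR (c * ln n%:R) :> R.
  by move=> n0; rewrite /powR pnatr_eq0 gtn_eqF.
pose d := c' * lq - 2 * c; have d0 : 0 < d by rewrite subr_gt0.
pose s n := Num.truncn (c' * ln (n%:R : R)).
have n1 : (\forall n \near \oo, (0 < n)%N)%classic by exact: nbhs_infty_ge.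
have lnM (M : R) : (\forall n \near \oo, M <= ln (n%:R : R))%classic.
  by move: M; apply/cvgryPge; exact: ln_natr_cvg_pinfty.
apply: (@generically_of_rate _ s (fun n => q%:R * expR (- (d * ln n%:R)))).
- near=> n.
  have n0 : (0 < n)%N by near: n.
  have L0 : 0 <= ln (n%:R : R) by rewrite ln_ge0 // ler1n.
  split.
  + by rewrite truncn_gt0 powRE // -[X in X <= _]expR0 ler_expR mulr_ge0 // ltW.
  + rewrite truncn_gt0 mulrC -ler_pdivrMr //; near: n; exact: lnM.
  (* With $L=\log n$, once $L\ge 6c'$ one gets $3s\le 3c'L\le L^2/2\le e^L=n$. *)
  + rewrite -(ler_nat R) natrM.
    have sL : (s n)%:R <= c' * ln (n%:R : R) by rewrite truncn_le mulr_ge0 // ltW.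
    have := expR_ge1Dxn 1 L0; rewrite lnK ?posrE ?ltr0n //.
    have : 6 * c' <= ln (n%:R : R) by near: n; exact: lnM.
    move: sL L0; set L := ln _; set S := (s n)%:R; set N := n%:R => SL L0 cL.
    have : 6 * c' * L <= L ^+ 2 by rewrite expr2 ler_wpM2r.
    by rewrite (_ : 2`! = 2)%N //; lra.
- near=> n => h -> /= lh.
  have n0 : (0 < n)%N by near: n.
  have L0 : 0 <= ln (n%:R : R) by rewrite ln_ge0 // ler1n.
  apply: (@le_trans _ _ (s n)%:R); first by rewrite ler_nat ltnW.
  by rewrite truncn_le mulr_ge0 // ltW.
- near=> n.
  have n0 : (0 < n)%N by near: n.
  have kL : (Num.truncn (n%:R `^ c))%:R <= expR (c * ln (n%:R : R)).
    by rewrite -powRE // truncn_le powR_ge0.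
  (* Truncation lowers the exponent by less than 1, which costs the factor [q] in the rate. *)
  have sL : expR (c' * ln (n%:R : R) * lq - lq) <= q%:R ^+ s n.
    rewrite -lqE -expRM_natl ler_expR.
    have := truncnS_gt (c' * ln (n%:R : R)); rewrite -/(s n) -natr1 => sL.
    have : (c' * ln n%:R) * lq <= ((s n)%:R + 1) * lq by rewrite ler_wpM2r // ltW.
    by lra.
  rewrite ler_pdivrMr ?exprn_gt0 ?(lt_trans _ q1) //.
  apply: (@le_trans _ _ (expR (c * ln n%:R) ^+ 2)).
    by rewrite lerXn2r ?nnegrE ?expR_ge0.
  apply: le_trans (ler_wpM2l _ sL); last by rewrite mulr_ge0 ?expR_ge0.
  rewrite -lqE -!expRD -expRM_natl ler_expR /d; lra.
- rewrite -(mulr0 (q%:R)); apply: cvgM; first exact: cvg_cst.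
  apply: (cvg_comp (fun n => d * ln n%:R) (fun x => expR (- x))); last exact: cvgr_expR.
  apply/cvgryPge => M; near=> n; rewrite mulrC -ler_pdivrMr //.
  by near: n; exact: lnM.
Unshelve. all: by end_near. Qed.

End Limits.

Theorem proposition3p24 (R : realType) (A : finType) (r : nat)
    (card_A : #|A| = r) (r_ge2 : (2 <= r)%N) :
  (forall (f : nat -> int) (k : nat),
      {homo f : m n / (m <= n)%N >-> m <= n} ->
      (forall M : int, exists n : nat, M < `|f n|) ->
      (1 < k)%N ->
      generically R (k := fun=> k)
        (fun n (h : 'I_k -> seq (letter A)) =>
           central_tree h && ((lcp h)%:Z <= f n)))
  /\
  (forall c c' : R,
      0 < c -> 0 < c' -> 2 * c < c' * ln (2 * r%:R - 1) ->
      generically R (k := fun n => Num.truncn (n%:R `^ c))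
        (fun n (h : 'I_(Num.truncn (n%:R `^ c)) -> seq (letter A)) =>
           central_tree h && ((lcp h)%:R <= c' * ln (n%:R : R)))).
Proof.
subst r; split=> [f k|c c']; first exact: generic_bounded_lcp.
exact: generic_log_lcp.
Qed.
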